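(* If $m,n$ are integers with $3 \leq m \leq n$, then $\mathrm{DOM}_t(P_m \Box P_n) \geq \frac{1}{2}mn + \frac{1}{2}m$.
   Context: An orientation of a (finite simple) graph $G$ is a digraph obtained by directing each edge $uv$ of $G$ in exactly one of the two directions $(u,v)$ or $(v,u)$. The orientation is valid if every vertex has in-degree at least $1$. A set $S\subseteq V(D)$ is a total dominating set of a digraph $D$ if every vertex of $D$ (including those in $S$) has an in-neighbor in $S$; $\gamma_t(D)$ is the minimum cardinality of a total dominating set of $D$. For a graph $G$ in which every component contains a cycle (equivalently, $G$ has a valid orientation), $\mathrm{DOM}_t(G)$ is the maximum of $\gamma_t(D)$ over all valid orientations $D$ of $G$. $P_m$ is the path on $m$ vertices, and $G\Box H$ is the Cartesian product: vertex set $V(G)\times V(H)$, with $(g,h)$ adjacent to $(g',h')$ iff either $g=g'$ and $hh'\in E(H)$, or $gg'\in E(G)$ and $h=h'$. *)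

(* Defs.v *)
From mathcomp Require Import all_boot.

Set Implicit Arguments.
Unset Strict Implicit.
Unset Printing Implicit Defensive.

Record sgraph (T : finType) := SGraph {
  adj :> rel T;
  adj_sym : symmetric adj;
  adj_irrefl : irreflexive adj }.

(* A digraph on T is given by its set of arcs; (u, v) is the arc from u to v. *)
Notation digraph T := {set (T * T)}.

Definition orientation (T : finType) (G : sgraph T) (D : digraph T) : bool :=
  [forall u, forall v,
    if G u v then ((u, v) \in D) (+) ((v, u) \in D) else (u, v) \notin D].

Definition indegree (T : finType) (D : digraph T) (v : T) : nat :=
  #|[set u | (u, v) \in D]|.

Definition valid_orientation (T : finType) (G : sgraph T) (D : digraph T) : bool :=
  orientation G D && [forall v, 1 <= indegree D v].

Definition total_dominating (T : finType) (D : digraph T) (S : {set T}) : bool :=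
  [forall v, exists u in S, (u, v) \in D].

(* A total dominating set exists exactly when every in-degree is positive, and
   then [set: T] is one; otherwise gamma_t D takes the irrelevant value #|T|. *)
Definition gamma_t (T : finType) (D : digraph T) : nat :=
  #|[arg min_(S < [set: T] | total_dominating D S) #|S|]|.

(* The value is 0 when G has no valid orientation. *)
Definition DOM_t (T : finType) (G : sgraph T) : nat :=
  \max_(D : digraph T | valid_orientation G D) gamma_t D.

Definition path_rel (m : nat) : rel 'I_m :=
  fun i j => (i.+1 == j :> nat) || (j.+1 == i :> nat).

Lemma path_rel_sym m : symmetric (@path_rel m).
Proof. by move=> i j; rewrite /path_rel orbC. Qed.

Lemma path_rel_irrefl m : irreflexive (@path_rel m).
Proof. by move=> i; rewrite /path_rel orbb; elim: (i : nat). Qed.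

Definition path_graph (m : nat) : sgraph 'I_m :=
  SGraph (@path_rel_sym m) (@path_rel_irrefl m).

Definition cart_rel (T U : finType) (G : sgraph T) (H : sgraph U) : rel (T * U) :=
  fun x y => ((x.1 == y.1) && H x.2 y.2) || (G x.1 y.1 && (x.2 == y.2)).

Lemma cart_rel_sym (T U : finType) (G : sgraph T) (H : sgraph U) :
  symmetric (cart_rel G H).
Proof.
move=> x y; rewrite /cart_rel (adj_sym G) (adj_sym H).
by rewrite (eq_sym x.1) (eq_sym x.2).
Qed.

Lemma cart_rel_irrefl (T U : finType) (G : sgraph T) (H : sgraph U) :
  irreflexive (cart_rel G H).
Proof. by move=> x; rewrite /cart_rel !adj_irrefl andbF. Qed.

Definition cart_prod (T U : finType) (G : sgraph T) (H : sgraph U) :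
    sgraph (T * U)%type :=
  SGraph (@cart_rel_sym T U G H) (@cart_rel_irrefl T U G H).

(* Main.v *)
Require Import Defs.
From mathcomp Require Import all_boot all_order all_algebra.
From mathcomp Require Import zify lra.

Set Implicit Arguments.
Unset Strict Implicit.
Unset Printing Implicit Defensive.

Import Order.TTheory GRing.Theory Num.Theory.
Local Open Scope ring_scope.

(** Let [D] be a digraph and [A] a set of vertices whose in-neighbourhoods are
    pairwise disjoint.  A total dominating set meets each of these
    in-neighbourhoods, so it has at least [#|A|] elements
    ([packing_leq_gamma_t]).

    Such an orientation is easy to get when [A] induces disjoint paths
    (strands).  Direct each strand from one end to the other, feed its first
    vertex from a neighbour outside [A], with distinct feeding vertices for
    distinct strands, and direct every other edge between [A] and its complement
    away from [A].  Then every vertex of [A] has exactly one in-neighbour, its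
    predecessor, and no vertex is the predecessor of two vertices of [A].  The
    orientation is valid as soon as each vertex outside [A] has a neighbour in
    [A] that it does not feed ([strand_leq_DOM_t]).

    In the grid with [m] rows and [n] columns, both numbered from 0, it remains
    to find strands with at least [m * (n + 1) / 2] vertices.

    - If [n] is odd, the columns 0, 2, ..., [n - 1] have exactly [m * (n + 1) / 2]
      vertices.  Column 0 is directed upwards and fed by the vertex
      [(m - 1, 1)]; column [j >= 2] is directed downwards and fed by
      [(0, j - 1)].  Reversing column 0 is what keeps the feeding vertices
      distinct.
    - If [n] is even, the columns 3, 5, ..., [n - 1], directed and fed in the same
      way, leave the columns 0 and 1 and the separating column 2.  In the
      first two columns take an induced path that winds downwards, missing one
      vertex in every odd row, on the right and on the left alternately (here
      for rows 0 to 8, [#] being a vertex of the path):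
[[
          # #     starts at (0, 1), fed by (1, 1)
          # .
          # #
          . #
          # #
          # .
          # #
          . #
          # #
]]
      It has two vertices in every even row and one in every odd row, hence at
      least [3 * m / 2] vertices, which together with the [m * (n - 2) / 2]
      vertices of the full columns is enough. *)

(** * Orientations with disjoint in-neighbourhoods *)

(** A total dominating set contains an in-neighbour of each vertex of [A], and
    disjointness makes these in-neighbours distinct. *)
Lemma packing_leq_gamma_t (T : finType) (D : digraph T) (A : {set T}) :
    [forall v, (1 <= indegree D v)%N] ->
    {in A &, forall a b u, (u, a) \in D -> (u, b) \in D -> a = b} ->
  (#|A| <= gamma_t D)%N.
Proof.
move=> indegD packA; rewrite /gamma_t.
case: arg_minnP => [|S domS _].
  apply/forallP => v; have := forallP indegD v.
  rewrite /indegree card_gt0 => /set0Pn[u]; rewrite inE => uv.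
  by apply/existsP; exists u; rewrite inE.
pose g a := odflt a [pick u in S | (u, a) \in D].
have gP a : g a \in S /\ (g a, a) \in D.
  rewrite /g; case: pickP => [u /andP[]//|none].
  have /existsP[u] := forallP domS a.
  by rewrite none.
rewrite -(card_in_imset (f := g) (D := mem A)).
  by apply/subset_leq_card/subsetP => _ /imsetP[a _ ->]; case: (gP a).
move=> a b aA bA eg; apply: (packA a b aA bA (g a)); first by case: (gP a).
by rewrite eg; case: (gP b).
Qed.

(** [P u v] reads: [u] is the predecessor of [v].  An edge between two vertices
    outside [A] may go either way; the enumeration of [T] decides. *)
Definition strand_digraph (T : finType) (G : sgraph T) (A : {set T}) (P : rel T) :
    digraph T :=
  [set uv | G uv.1 uv.2 &&
    (if uv.2 \in A then P uv.1 uv.2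
     else if uv.1 \in A then ~~ P uv.2 uv.1
     else (enum_rank uv.1 < enum_rank uv.2)%N)].

Lemma strand_digraph_valid (T : finType) (G : sgraph T) (A : {set T}) (P : rel T) :
    {in A &, forall a b, G a b -> P a b (+) P b a} ->
    {in A, forall a, exists2 u, G u a & P u a} ->
    (forall v, v \notin A -> exists u, [/\ G u v, u \in A & ~~ P v u]) ->
  valid_orientation G (strand_digraph G A P).
Proof.
move=> PA P_ex out_ex.
apply/andP; split.
  apply/forallP => u; apply/forallP => v; rewrite !inE /= (adj_sym G v u).
  case: ifP => Guv /=; last by rewrite Guv.
  have [uA|uA] := boolP (u \in A); have [vA|vA] := boolP (v \in A) => //.
  - by rewrite Guv; exact: PA.
  - by rewrite Guv; case: (P v u).
  - by rewrite Guv; case: (P u v).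
  have : u != v by apply: contraTneq Guv => ->; rewrite adj_irrefl.
  by rewrite Guv -(inj_eq enum_rank_inj) -val_eqE neq_ltn /=; case: ltngtP.
apply/forallP => v; rewrite /indegree card_gt0; apply/set0Pn.
have [vA|vA] := boolP (v \in A).
  by have [u Guv Puv] := P_ex _ vA; exists u; rewrite !inE /= Guv vA.
have [u [Guv uA nP]] := out_ex _ vA.
by exists u; rewrite !inE /= Guv uA (negPf vA).
Qed.

(** The in-neighbours of a vertex of [A] in [strand_digraph] are predecessors of
    it, so the injectivity of [P] on [A] makes [A] a packing. *)
Lemma strand_leq_DOM_t (T : finType) (G : sgraph T) (A : {set T}) (P : rel T) :
    {in A &, forall a b, G a b -> P a b (+) P b a} ->
    {in A &, forall a b u, P u a -> P u b -> a = b} ->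
    {in A, forall a, exists2 u, G u a & P u a} ->
    (forall v, v \notin A -> exists u, [/\ G u v, u \in A & ~~ P v u]) ->
  (#|A| <= DOM_t G)%N.
Proof.
move=> PA P_inj P_ex out_ex.
have valD := strand_digraph_valid PA P_ex out_ex.
apply: leq_trans (leq_bigmax_cond (F := @gamma_t T) _ valD).
apply: packing_leq_gamma_t; first by case/andP: valD.
by move=> a b aA bA u; rewrite !inE /= aA bA => /andP[_ Pa] /andP[_]; exact: P_inj.
Qed.

(** * Strands in the grid *)

(** The parameter [oddn] is the parity of the number of columns.  The test on
    [odd j] selects full columns, which for even [n] start at column 3; the
    residues modulo 4 describe the winding path in the columns 0 and 1. *)
Definition on_strand (oddn : bool) (i j : nat) : bool :=
  if oddn || (1 < j)%N then odd j (+) oddn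
  else if j == 0%N then (i %% 4 != 3)%N else (i %% 4 != 1)%N.

(** The predecessor of the strand vertex [(i, j)] in a grid with [m] rows; for the
    first vertex of a strand this is the vertex off the strands that feeds it. *)
Definition strand_pred (m : nat) (oddn : bool) (i j : nat) : nat * nat :=
  if (1 < j)%N then (if i == 0%N then (0, j.-1) else (i.-1, j))%N
  (* column 0 of a grid with an odd number of columns runs upwards *)
  else if oddn then (if i.+1 == m then (i, 1) else (i.+1, 0))%N
  (* the winding path enters column 0 in the rows 0, 4, 8, ... *)
  else if j == 0%N then (if i %% 4 == 0 then (i, 1) else (i.-1, 0))%N
  else if i == 0%N then (1, 1)%N
  (* and it comes back to column 1 in the rows 2, 6, 10, ... *)
  else if (i %% 4 == 2)%N then (i, 0)%N else (i.-1, 1)%N.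

Definition nat_adj (i j i' j' : nat) : bool :=
  ((i == i') && ((j.+1 == j') || (j'.+1 == j))) ||
  (((i.+1 == i') || (i'.+1 == i)) && (j == j')).

(** The strands are induced paths: adjacent strand vertices are consecutive on
    one strand. *)
Lemma strand_pred_asym m oddn i j i' j' : (i < m)%N -> (i' < m)%N ->
  on_strand oddn i j -> on_strand oddn i' j' -> nat_adj i j i' j' ->
  ((i, j) == strand_pred m oddn i' j') (+) ((i', j') == strand_pred m oddn i j).
Proof.
rewrite /on_strand /strand_pred /nat_adj; case: oddn; rewrite /= => im im'.
  by do ![case: ifP => ?]; rewrite !xpair_eqE; lia.
by do ![case: ifP => ?]; rewrite !xpair_eqE; lia.
Qed.

(** Distinct strands are fed by distinct vertices.  This takes at least two rows:
    in a single row with [oddn], the vertex [(0, 1)] would feed both column 0 and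
    column 2. *)
Lemma strand_pred_inj m oddn i j i' j' : (1 < m)%N -> (i < m)%N -> (i' < m)%N ->
  on_strand oddn i j -> on_strand oddn i' j' ->
  strand_pred m oddn i j = strand_pred m oddn i' j' -> i = i' /\ j = j'.
Proof.
rewrite /on_strand /strand_pred; case: oddn; rewrite /= => m1 im im'.
  by do ![case: ifP => ?]; move=> ? ? /eqP; rewrite xpair_eqE; lia.
by do ![case: ifP => ?]; move=> ? ? /eqP; rewrite xpair_eqE; lia.
Qed.

Lemma strand_pred_grid m n i j : (1 < m)%N -> (1 < n)%N -> (i < m)%N -> (j < n)%N ->
  on_strand (odd n) i j ->
  let p := strand_pred m (odd n) i j in
  [/\ (p.1 < m)%N, (p.2 < n)%N & nat_adj p.1 p.2 i j].
Proof.
rewrite /on_strand /strand_pred /nat_adj => m1 n1 im jn.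
case: (odd n) => /=; do ![case: ifP => ?] => /= ?; split; lia.
Qed.

Lemma off_strand_neighbor m n i j : (1 < m)%N -> (1 < n)%N -> (i < m)%N -> (j < n)%N ->
  ~~ on_strand (odd n) i j ->
  exists p : nat * nat, [/\ (p.1 < m)%N, (p.2 < n)%N, nat_adj p.1 p.2 i j,
    on_strand (odd n) p.1 p.2 & (i, j) != strand_pred m (odd n) p.1 p.2].
Proof.
move=> m1 n1 im jn off.
(* The right neighbour will do, except in row 0, where the vertex may feed it,
   and for the gaps of the winding path in column 1, where it is off the
   strands. *)
exists (if (i == 0%N) || (~~ odd n && (j == 1%N)) then (i, j.-1) else (i, j.+1)).
move: off; rewrite /on_strand /strand_pred /nat_adj.
case: (boolP (odd n)) => /=.
  by do ![case: ifP => /= ?] => ? ?; rewrite !xpair_eqE; split; lia.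
by do ![case: ifP => /= ?] => ? ?; rewrite !xpair_eqE; split; lia.
Qed.

(** * Counting strand vertices *)

Lemma row_count_odd i k :
  (\sum_(0 <= j < k.*2.+1) on_strand true i j = k.+1)%N.
Proof.
elim: k => [|k IH]; first by rewrite big_nat1.
rewrite doubleS 2?big_nat_recr //= {}IH /on_strand /=; lia.
Qed.

Lemma row_count_even i k :
  (\sum_(0 <= j < k.*2.+2) on_strand false i j = k.+2 - odd i)%N.
Proof.
elim: k => [|k IH].
  rewrite big_nat_recr // big_nat1 /on_strand /=; lia.
rewrite doubleS 2?big_nat_recr //= {}IH /on_strand /=; lia.
Qed.

Lemma row_count n i : (0 < n)%N ->
  (2 * \sum_(0 <= j < n) on_strand (odd n) i j
     = n + (if odd n then 1 else (~~ odd i).*2))%N.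
Proof.
case: n => // n _; case: (boolP (odd n.+1)) => odd_n.
  have -> : n.+1 = n./2.*2.+1 by lia.
  rewrite row_count_odd; lia.
have -> : n.+1 = n./2.*2.+2 by lia.
rewrite row_count_even; lia.
Qed.

Definition strand_set m n : {set 'I_m * 'I_n} :=
  [set x : 'I_m * 'I_n | on_strand (odd n) x.1 x.2].

Lemma card_strand_set m n : (0 < n)%N -> (m * n.+1 <= 2 * #|strand_set m n|)%N.
Proof.
move=> n0.
have -> : #|strand_set m n| =
    (\sum_(0 <= i < m) \sum_(0 <= j < n) on_strand (odd n) i j)%N.
  rewrite -sum1dep_card big_mkcond /= big_mkord.
  rewrite -(pair_bigA _ (fun (i : 'I_m) (j : 'I_n) =>
    if on_strand (odd n) i j then 1%N else 0%N)) /=.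
  by apply: eq_bigr => i _; rewrite big_mkord; apply: eq_bigr => j _; case: on_strand.
(* For even n the rows 0, 2, ... have n + 2 strand vertices and the others n,
   counted twice, so an odd number of rows gives one more. *)
suff: (m * n.+1 + (odd m && ~~ odd n)
    <= 2 * \sum_(0 <= i < m) \sum_(0 <= j < n) on_strand (odd n) i j)%N by lia.
elim: m => [|m IH]; first by rewrite big_geq.
rewrite big_nat_recr //= mulnDr mulSn.
by move: IH (row_count m n0); case: (odd n); lia.
Qed.

Lemma strands_leq_DOM_t m n : (1 < m)%N -> (1 < n)%N ->
  (#|strand_set m n| <= DOM_t (cart_prod (path_graph m) (path_graph n)))%N.
Proof.
move=> m1 n1.
pose P (x y : 'I_m * 'I_n) :=
  (x.1 : nat, x.2 : nat) == strand_pred m (odd n) y.1 y.2.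
apply: (strand_leq_DOM_t (P := P)).
- move=> [i j] [i' j']; rewrite !inE /= => on_ij on_ij' adj_ij.
  exact: strand_pred_asym.
- move=> [i j] [i' j']; rewrite !inE /= => on_ij on_ij' [k l].
  rewrite /P /= => /eqP-> /eqP; case/strand_pred_inj => //.
  by move=> /val_inj-> /val_inj->.
- move=> [i j]; rewrite inE /= => on_ij.
  have [km ln kl] := strand_pred_grid m1 n1 (ltn_ord i) (ltn_ord j) on_ij.
  by exists (Ordinal km, Ordinal ln); rewrite // /P /= -surjective_pairing.
- move=> [i j]; rewrite inE /= => off_ij.
  have [p [km ln kl on_p nP]] :=
    off_strand_neighbor m1 n1 (ltn_ord i) (ltn_ord j) off_ij.
  by exists (Ordinal km, Ordinal ln); rewrite inE.
Qed.

Theorem theorem4p11 (m n : nat) (hm : (3 <= m)%N) (hmn : (m <= n)%N) :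
  (1 / 2 : rat) * m%:R * n%:R + (1 / 2 : rat) * m%:R
    <= (DOM_t (cart_prod (path_graph m) (path_graph n)))%:R.
Proof.
have m1 : (1 < m)%N by lia.
have n1 : (1 < n)%N by lia.
have := card_strand_set m (ltnW n1); have := strands_leq_DOM_t m1 n1.
set d := DOM_t _ => le_d le_card.
have : (m * n + m <= 2 * d)%N by lia.
rewrite -(ler_nat rat) natrD !natrM; lra.
Qed.
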